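(* Let $\mathcal{M}^-$ denote the axiom system of the Hilbert plane with the Side-Angle-Side axiom removed (incidence, betweenness, and congruence axioms (C1)–(C5) as listed in the context; no continuity or parallel axiom). In every model of $\mathcal{M}^-$ in which the principles [HA] (hypotenuse-angle criterion for right triangles), [RCT] (ray correspondence) and [PE] (existence of the perpendicular from an external point), as spelled out in the context, all hold, the following two criteria hold for all triangles $\triangle ABC$ and $\triangle DEF$: (SSS) if $AB\equiv DE$, $BC\equiv EF$ and $CA\equiv FD$, then $\triangle ABC\equiv\triangle DEF$; (SAA) if $AC\equiv DF$, $\angle BAC\equiv\angle EDF$ and $\angle ABC\equiv\angle DEF$, then $\triangle ABC\equiv\triangle DEF$ (in both cases with $A,B,C$ corresponding to $D,E,F$ respectively).
   Context: **The axiom system $\mathcal{M}^-$.** Primitive notions: points, lines (with incidence), betweenness of points (written $A*B*C$: $B$ is between $A$ and $C$), congruence $\equiv$ of segments, congruence $\equiv$ of angles. The segment $AB$ ($A\neq B$) consists of $A$, $B$ and the points between them. The ray $\overrightarrow{AB}$ consists of $A$ and the points of line $AB$ on the same side of $A$ as $B$. An angle $\angle BAC$ is the unordered pair of rays $\overrightarrow{AB},\overrightarrow{AC}$ with $A,B,C$ not collinear. A triangle $\triangle ABC$ is determined by three non-collinear points. Incidence: (I1) any two distinct points lie on exactly one line; (I2) every line contains at least two points; (I3) there are three non-collinear points. Betweenness: (B1) if $A*B*C$ then $A,B,C$ are distinct and collinear and $C*B*A$; (B2) for distinct $A,B$ there is $C$ with $A*B*C$; (B3) of three distinct collinear points exactly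 one is between the other two; (B4) (Pasch) if $A,B,C$ are non-collinear and a line $l$ contains none of them but contains a point between $A$ and $B$, then $l$ contains a point between $A$ and $C$ or a point between $B$ and $C$, but not both. Congruence: (C1) given a segment $AB$ and a ray with origin $C$, there is a unique point $D\ne C$ on the ray with $AB\equiv CD$; (C2) segment congruence is an equivalence relation; (C3) if $A*B*C$, $D*E*F$, $AB\equiv DE$ and $BC\equiv EF$, then $AC\equiv DF$; (C4) given an angle $\angle BAC$, a ray $\overrightarrow{DF}$ and a side of line $DF$, there is a unique ray $\overrightarrow{DE}$ on that side with $\angle BAC\equiv\angle EDF$; (C5) angle congruence is an equivalence relation. The Hilbert plane is $\mathcal{M}^-$ together with the Side-Angle-Side criterion as a further axiom (C6); it is not assumed in $\mathcal{M}^-$. **Definitions.** Two triangles $\triangle ABC$ and $\triangle DEF$ are congruent, $\triangle ABC\equiv\triangle DEF$, if $AB\equiv DE$, $BC\equiv EF$, $CA\equiv FD$, $\angle A\equiv\angle D$, $\angle B\equiv\angle E$, $\angle C\equiv\angle F$. Two angles are supplementary if they share one side and their other sides are opposite rays. An angle is right if it is congruent to a supplementary angle of it. It is not assumed that all right angles are congruent to one another. Two lines are perpendicular if they meet at a point $O$ and some ray of one and some ray of the other, both with origin $O$, form a right angle. A right triangle is a triangle with a right angle at a designated vertex; its hypotenuse is the side opposite that vertex, and its ''acute angles'' are the angles at the other two vertices. A ray with origin $A$ lies within $\angle BAC$ if its points other than $A$ are on the same side of line $AB$ as $C$ and on the same side of line $AC$ as $B$. **The principles.** [HA] If $\triangle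 ABC$ has a right angle at $C$, $\triangle DEF$ has a right angle at $F$, $AB\equiv DE$ and $\angle BAC\equiv\angle EDF$, then $\triangle ABC\equiv\triangle DEF$. [RCT] (Hilbert's Theorem 13.) If the angle formed by rays $h,k$ is congruent to the angle formed by rays $h',k'$, and $l$ is a ray from the vertex of $\angle(h,k)$ lying within $\angle(h,k)$, then there is a ray $l'$ from the vertex of $\angle(h',k')$ lying within $\angle(h',k')$ such that $\angle(h,l)\equiv\angle(h',l')$ and $\angle(k,l)\equiv\angle(k',l')$. [PE] Given a line $l$ and a point $P$ not on $l$, there exists a line through $P$ perpendicular to $l$. *)

(* Defs.v *)
From mathcomp Require Import all_boot.
From mathcomp Require Import boolp classical_sets.

Set Implicit Arguments.
Unset Strict Implicit.
Unset Printing Implicit Defensive.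

Local Open Scope classical_set_scope.

(* Segments are sets of points and angles are unordered pairs of rays, i.e. sets
   of sets of points, so that [seg A B = seg B A], [ang B A C = ang C A B] and
   the independence of an angle from the points chosen on its sides are not
   extra axioms.  The congruence relations are only constrained, and only used,
   on genuine segments and genuine angles. *)
Record geometry := Geometry {
  Point : Type;
  Line : Type;
  on : Point -> Line -> Prop;
  between : Point -> Point -> Point -> Prop; (* between A B C is A * B * C *)
  segcong : set Point -> set Point -> Prop;
  angcong : set (set Point) -> set (set Point) -> Prop }.

Section Definitions.
Variable G : geometry.
Implicit Types (A B C D E F O P Q X : Point G) (l m : Line G).
Implicit Types (r : set (Point G)) (a b : set (set (Point G))).

Definition collinear A B C := exists l, [/\ on A l, on B l & on C l].

(* Meaningful for A <> B. *)
Definition seg A B : set (Point G) :=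
  [set X | [\/ X = A, X = B | between A X B]].

(* Meaningful for A <> B. *)
Definition ray A B : set (Point G) :=
  [set X | X = A \/ [/\ X <> A, collinear A B X & ~ between B A X]].

Definition ray_from A r := exists2 B, B <> A & r = ray A B.

(* The angle with vertex A and sides AB, AC; meaningful for A, B, C
   non-collinear. *)
Definition ang B A C : set (set (Point G)) := [set ray A B; ray A C].

Definition is_segment (s : set (Point G)) :=
  exists A B, A <> B /\ s = seg A B.

Definition is_angle a := exists B A C, ~ collinear B A C /\ a = ang B A C.

Definition same_side l P Q :=
  [/\ ~ on P l, ~ on Q l & ~ exists2 X, on X l & between P X Q].

(* P and Q are on the same side of the line AB. *)
Definition same_side_of A B P Q :=
  exists l, [/\ on A l, on B l & same_side l P Q].

Definition triangle_cong A B C D E F :=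
  [/\ segcong (seg A B) (seg D E),
      segcong (seg B C) (seg E F) &
      segcong (seg C A) (seg F D)] /\
  [/\ angcong (ang B A C) (ang E D F),
      angcong (ang A B C) (ang D E F) &
      angcong (ang A C B) (ang D F E)].

Definition supplementary a b :=
  exists B A C D, [/\ ~ collinear B A C, between B A D,
                      a = ang B A C & b = ang D A C].

Definition right_angle a := exists2 b, supplementary a b & angcong a b.

Definition perpendicular l m :=
  exists O P Q, [/\ on O l /\ on O m, on P l /\ P <> O, on Q m /\ Q <> O
                  & right_angle (ang P O Q)].

(* The ray r with origin A lies within the angle BAC. *)
Definition within r B A C :=
  ray_from A r /\
  forall X, r X -> X <> A -> same_side_of A B X C /\ same_side_of A C X B.

(* The axiom system M^-: Hilbert plane without side-angle-side. *)
Record hilbert_minus : Prop := HilbertMinus {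
  (* "Three points" in I3 means three distinct points: otherwise one point and
     no line would be a model. *)
  I1 : forall A B, A <> B -> exists! l, on A l /\ on B l;
  I2 : forall l, exists A B, [/\ A <> B, on A l & on B l];
  I3 : exists A B C, [/\ A <> B, A <> C, B <> C & ~ collinear A B C];

  B1 : forall A B C, between A B C ->
    [/\ A <> B, A <> C, B <> C, collinear A B C & between C B A];
  B2 : forall A B, A <> B -> exists C, between A B C;
  B3 : forall A B C, A <> B -> A <> C -> B <> C -> collinear A B C ->
    [\/ [/\ between A B C, ~ between B A C & ~ between A C B],
        [/\ ~ between A B C, between B A C & ~ between A C B] |
        [/\ ~ between A B C, ~ between B A C & between A C B]];
  B4 : forall A B C l, ~ collinear A B C ->
    ~ on A l -> ~ on B l -> ~ on C l ->
    (exists2 X, on X l & between A X B) ->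
    ((exists2 X, on X l & between A X C) \/
     (exists2 X, on X l & between B X C)) /\
    ~ ((exists2 X, on X l & between A X C) /\
       (exists2 X, on X l & between B X C));

  C1 : forall A B C r, A <> B -> ray_from C r ->
    exists! D, [/\ D <> C, r D & segcong (seg A B) (seg C D)];
  C2_refl : forall s, is_segment s -> segcong s s;
  C2_sym : forall s t, is_segment s -> is_segment t ->
    segcong s t -> segcong t s;
  C2_trans : forall s t u, is_segment s -> is_segment t -> is_segment u ->
    segcong s t -> segcong t u -> segcong s u;
  C3 : forall A B C D E F, between A B C -> between D E F ->
    segcong (seg A B) (seg D E) -> segcong (seg B C) (seg E F) ->
    segcong (seg A C) (seg D F);
  (* The side of the line DF is given by a point P off that line. *)
  C4 : forall B A C D F P, ~ collinear B A C -> D <> F -> ~ collinear D F P ->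
    exists! r, [/\ ray_from D r,
      forall X, r X -> X <> D -> same_side_of D F X P
      & angcong (ang B A C) [set r; ray D F]];
  C5_refl : forall a, is_angle a -> angcong a a;
  C5_sym : forall a b, is_angle a -> is_angle b -> angcong a b -> angcong b a;
  C5_trans : forall a b c, is_angle a -> is_angle b -> is_angle c ->
    angcong a b -> angcong b c -> angcong a c }.

(* Hypotenuse-angle criterion for right triangles. *)
Definition HA := forall A B C D E F,
  ~ collinear A B C -> ~ collinear D E F ->
  right_angle (ang A C B) -> right_angle (ang D F E) ->
  segcong (seg A B) (seg D E) -> angcong (ang B A C) (ang E D F) ->
  triangle_cong A B C D E F.

(* Ray correspondence. *)
Definition RCT := forall B A C B' A' C',
  ~ collinear B A C -> ~ collinear B' A' C' ->
  angcong (ang B A C) (ang B' A' C') ->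
  forall r, within r B A C ->
  exists r', [/\ within r' B' A' C',
    angcong [set ray A B; r] [set ray A' B'; r']
    & angcong [set ray A C; r] [set ray A' C'; r']].

(* Perpendicular from an external point. *)
Definition PE := forall l P, ~ on P l -> exists2 m, on P m & perpendicular m l.

End Definitions.

(* Main.v *)
Require Import Defs.
From mathcomp Require Import all_boot.
From mathcomp Require Import boolp classical_sets.

(* (RCT) and the uniqueness in (C4) yield the calculus of angles: differences,
   sums and supplements of congruent angles are congruent.  (HA) makes the foot
   of a perpendicular unique, because a point of the line beyond both feet
   would see them as ends of congruent legs on one ray.  Hence the angles of a
   right triangle other than the right one are acute, so the foot of an endpoint
   of an oblique side lies on the expected side of the vertex.  A right triangle
   can therefore be rebuilt anywhere from its hypotenuse and an acute angle by
   (PE) and (HA), which gives side-angle-side for right triangles, and cutting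
   along an altitude extends it to all triangles.  (SSS) and (SAA) then follow
   as in Hilbert's Grundlagen. *)

Set Implicit Arguments.
Unset Strict Implicit.
Unset Printing Implicit Defensive.

Local Open Scope classical_set_scope.

Local Notation cong A B C D := (segcong (seg A B) (seg C D)).
Local Notation acong B A C E D F := (angcong (ang B A C) (ang E D F)).

Definition opposite (G : geometry) (A B P Q : Point G) :=
  exists2 X, collinear A B X & between P X Q.

(* Unlike [same_side_of], this speaks of points only; [same_side_ofE] relates
   the two. *)
Definition sameside (G : geometry) (A B P Q : Point G) :=
  [/\ ~ collinear A B P, ~ collinear A B Q & ~ opposite A B P Q].

(** Membership in a ray without its origin, which makes the relation symmetric in [X] and [Y]; see
    [rayP] and [ray_eq]. *)
Definition sameray (G : geometry) (A X Y : Point G) :=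
  [/\ X <> A, Y <> A, collinear A X Y & ~ between X A Y].

(** * Incidence and betweenness *)

Section Order.
Variables (G : geometry) (HM : hilbert_minus G).
Implicit Types (A B C D E F O P Q R X Y Z : Point G).

Lemma exists_neq A : exists B, B <> A.
Proof.
case: (I3 HM) => U [V] [W] [UV _ _ _].
by have [<-|] := pselect (U = A); [exists V => e; apply: UV | exists U].
Qed.

Lemma exists_line A B : exists l, on A l /\ on B l.
Proof.
have [<-|AB] := pselect (A = B); last by case: (I1 HM AB) => l [h _]; exists l.
have [C CA] := exists_neq A.
by case: (I1 HM CA) => l [[_ h] _]; exists l.
Qed.

Lemma line_uniq A B l m :
  A <> B -> on A l -> on B l -> on A m -> on B m -> l = m.
Proof.
move=> AB Al Bl Am Bm; case: (I1 HM AB) => k [_ h].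
by rewrite -(h l (conj Al Bl)) -(h m (conj Am Bm)).
Qed.

Lemma collinear_on A B l X :
  A <> B -> on A l -> on B l -> collinear A B X <-> on X l.
Proof.
move=> AB Al Bl; split=> [[m [Am Bm Xm]]|Xl]; last by exists l.
by rewrite (line_uniq AB Al Bl Am Bm).
Qed.

Lemma col_aab A B : collinear A A B.
Proof. by case: (exists_line A B) => l []; exists l. Qed.

Lemma col_bac A B C : collinear A B C -> collinear B A C.
Proof. by case=> l []; exists l. Qed.

Lemma col_acb A B C : collinear A B C -> collinear A C B.
Proof. by case=> l []; exists l. Qed.

Lemma col_line A B C D E : A <> B ->
  collinear A B C -> collinear A B D -> collinear A B E -> collinear C D E.
Proof.
move=> AB hC [l [Al Bl Dl]] hE; exists l; split=> //;
  by apply/(collinear_on _ AB Al Bl).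
Qed.

Lemma col_via A B C D E : A <> B -> C <> D ->
  collinear A B C -> collinear A B D -> collinear C D E -> collinear A B E.
Proof.
move=> AB CD [l [Al Bl Cl]] [m [Am Bm Dm]] hE; exists l; split=> //.
rewrite (line_uniq AB Am Bm Al Bl) in Dm.
by apply/(collinear_on _ CD Cl Dm).
Qed.

Lemma ncol_neq A B C : ~ collinear A B C -> [/\ A <> B, B <> C & A <> C].
Proof.
move=> h; split=> e; apply: h; rewrite e.
- exact: col_aab.
- exact/col_bac/col_acb/col_aab.
- exact/col_acb/col_aab.
Qed.

Lemma btw_facts A B C : between A B C ->
  [/\ A <> B, A <> C, B <> C & collinear A B C].
Proof. by case/(B1 HM). Qed.

Lemma btw_sym A B C : between A B C -> between C B A.
Proof. by case/(B1 HM). Qed.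

Lemma btw_excl A B C : between A B C -> ~ between B A C /\ ~ between A C B.
Proof.
move=> h; have [AB AC BC c] := btw_facts h.
by case: (B3 HM AB AC BC c) => [] [].
Qed.

End Order.

(** * Automation for collinearity and distinctness *)

Ltac col_perm :=
  solve [ assumption
        | apply: col_bac; assumption
        | apply: col_acb; assumption
        | apply: col_bac; apply: col_acb; assumption
        | apply: col_acb; apply: col_bac; assumption
        | apply: col_bac; apply: col_acb; apply: col_bac; assumption
        | match goal with HM : hilbert_minus _ |- _ =>
            first [ exact: (col_aab HM)
                  | apply: col_acb; exact: (col_aab HM)
                  | apply: col_bac; apply: col_acb; exact: (col_aab HM) ]
          end ].

Ltac col_pos :=
  first [ col_perm
        | match goal with
          HM_ : hilbert_minus _, ne_ : ?A <> ?B |- collinear ?X ?Y ?Z =>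
            apply: (col_line HM_ ne_); col_perm
          end
        | match goal with
          HM_ : hilbert_minus _, ne_ : ?C <> ?D |- collinear ?X ?Y ?Z =>
            first [ apply: (@col_via _ HM_ X Y C D Z);
                      [assumption | assumption | col_perm..]
                  | apply: col_acb; apply: (@col_via _ HM_ X Z C D Y);
                      [assumption | assumption | col_perm..]
                  | apply: col_bac; apply: col_acb; apply: (@col_via _ HM_ Y Z C D X);
                      [assumption | assumption | col_perm..] ]
          end ].

(* Closes [collinear X Y Z], or its negation from a negated hypothesis, by
   at most one change of the two points that span the line. *)
Ltac col :=
  first [ col_pos
        | let H := fresh "fact" in intro H;
          match goal with nc_ : ~ collinear _ _ _ |- _ =>
            apply: nc_; col_pos
          end ].

(** The context is what [col] and [neq] search, so no fact is entered twice. *)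
Ltac note h := let T := type of h in
  lazymatch goal with
  | _ : T |- _ => idtac
  | _ => let H := fresh "fact" in have H := h
  end.

Ltac note_neq HM h :=
  let a := fresh "fact" in let b := fresh "fact" in let c := fresh "fact" in
  have [a b c] := ncol_neq HM h;
  note (not_eq_sym a); note (not_eq_sym b); note (not_eq_sym c).

Ltac note_btw HM h :=
  let a := fresh "fact" in let b := fresh "fact" in let c := fresh "fact" in let d := fresh "fact" in
  have [a b c d] := btw_facts HM h;
  note (not_eq_sym a); note (not_eq_sym b); note (not_eq_sym c).

(** The last resort assumes the equality and substitutes it, so that a known inequality or a known
    non-collinearity fails. *)
Ltac neq :=
  solve [ assumption | apply: not_eq_sym; assumption
        | let e := fresh "fact" in intro e; subst;
          first [ contradiction
                | match goal with nc_ : ~ collinear _ _ _ |- _ => apply: nc_; col_pos end ] ].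

(** * Plane separation *)

Section Sides.
Variables (G : geometry) (HM : hilbert_minus G).
Implicit Types (A B C D E F O P Q R X Y Z : Point G).

Lemma exists_ncol A B : A <> B -> exists C, ~ collinear A B C.
Proof.
move=> AB; case: (I3 HM) => U [V] [W] [UV UW VW n].
have [hU|hU] := pselect (collinear A B U); last by exists U.
have [hV|hV] := pselect (collinear A B V); last by exists V.
exists W => hW; apply: n; col.
Qed.

Lemma opposite_sym A B P Q : opposite A B P Q -> opposite A B Q P.
Proof. by case=> X h /(btw_sym HM); exists X. Qed.

Lemma sameside_sym A B P Q : sameside A B P Q -> sameside A B Q P.
Proof. by case=> hP hQ h; split=> // /opposite_sym. Qed.

Lemma sameside_refl A B P : ~ collinear A B P -> sameside A B P P.
Proof. by move=> h; split=> // -[X _ /(btw_facts HM)[]]. Qed.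

Lemma sameside_or_opposite A B P Q : ~ collinear A B P -> ~ collinear A B Q ->
  sameside A B P Q \/ opposite A B P Q.
Proof. by move=> hP hQ; have [|] := pselect (opposite A B P Q); [right|left]. Qed.

Lemma opposite_line A B C D P Q : A <> B -> C <> D ->
  collinear A B C -> collinear A B D ->
  opposite A B P Q -> opposite C D P Q.
Proof. by move=> AB CD hC hD [X hX b]; exists X => //; col. Qed.

Lemma sameside_line A B C D P Q : A <> B -> C <> D ->
  collinear A B C -> collinear A B D ->
  sameside A B P Q -> sameside C D P Q.
Proof.
move=> AB CD hC hD [hP hQ h].
have hA : collinear C D A by col.
have hB : collinear C D B by col.
by split; [col | col | move/(opposite_line CD AB hA hB)].
Qed.

Lemma same_side_ofE A B P Q : A <> B ->
  same_side_of A B P Q <-> sameside A B P Q.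
Proof.
move=> AB; split=> [[l [Al Bl [Pl Ql h]]]|[hP hQ h]].
  have onE X := collinear_on HM X AB Al Bl.
  by split=> [/onE|/onE|[X /onE Xl b]] //; apply: h; exists X.
have [l [Al Bl]] := exists_line HM A B.
have onE X := collinear_on HM X AB Al Bl.
exists l; split=> //; split=> [/onE|/onE|[X /onE Xl b]] //.
by apply: h; exists X.
Qed.

Lemma pasch A B P Q R : A <> B -> ~ collinear P Q R ->
  ~ collinear A B P -> ~ collinear A B Q -> ~ collinear A B R ->
  opposite A B P Q ->
  (opposite A B P R \/ opposite A B Q R) /\
  ~ (opposite A B P R /\ opposite A B Q R).
Proof.
move=> AB n hP hQ hR o.
have [l [Al Bl]] := exists_line HM A B.
have onE X := collinear_on HM X AB Al Bl.
have oE U V : opposite A B U V <-> exists2 X, on X l & between U X V.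
  by split=> -[X hX b]; exists X => //; apply/onE.
rewrite !oE; apply: (B4 HM n) => [/onE|/onE|/onE|] //; exact/oE.
Qed.

Lemma sameside_trans_ncol A B P Q R : A <> B -> ~ collinear P Q R ->
  sameside A B P Q -> sameside A B Q R -> sameside A B P R.
Proof.
move=> AB n [hP hQ nPQ] [_ hR nQR]; split=> // o.
have n' : ~ collinear P R Q by col.
by case: (pasch AB n' hP hR hQ o) => -[//|/opposite_sym].
Qed.

Lemma opposite_trans_ncol A B P Q R : A <> B -> ~ collinear P Q R ->
  ~ collinear A B P -> ~ collinear A B Q -> ~ collinear A B R ->
  opposite A B P Q -> opposite A B Q R -> sameside A B P R.
Proof.
move=> AB n hP hQ hR oPQ oQR; split=> // oPR.
by case: (pasch AB n hP hQ hR oPQ) => _; apply.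
Qed.

(* Reduces the collinear cases of plane separation to the triangular ones. *)
Lemma sameside_off_line A B P Q : A <> B -> P <> Q -> ~ collinear A B P ->
  exists2 E, sameside A B P E & ~ collinear P Q E.
Proof.
move=> AB PQ hP.
(* Since [P] is off [AB], one of [A] and [B] is off [PQ]. The point [E] is taken beyond [P] as seen
   from it, so the segment from [P] to [E] misses [AB]. *)
have [D [hD nD]] : exists D, collinear A B D /\ ~ collinear P Q D.
  have [h|] := pselect (collinear P Q A); last by exists A; split=> //; col.
  exists B; split; first by col.
  by move=> h'; apply: hP; col.
have [E b] : exists E, between D P E by apply: (B2 HM); neq.
note_btw HM b; exists E; last by col.
split=> //; first by move=> h; apply: hP; col.
case=> X hX b'; note_btw HM b'.
have c : collinear X D P by col.
have [e|XD] := pselect (X = D); last by apply: hP; col.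
by subst X; case: (btw_excl HM b).
Qed.

(** Pasch settles the case of a triangle. For collinear points the auxiliary [E] off their line
    replaces the one step by three triangular ones. *)
Lemma sameside_trans A B P Q R : A <> B ->
  sameside A B P Q -> sameside A B Q R -> sameside A B P R.
Proof.
move=> AB sPQ sQR; have [hP hQ _] := sPQ; have [_ hR _] := sQR.
have [c|] := pselect (collinear P Q R); last by move/sameside_trans_ncol; apply.
have [->//|PQ] := pselect (P = Q); have [<-//|QR] := pselect (Q = R).
have [<-|PR] := pselect (P = R); first exact: sameside_refl.
have [E sPE n] := sameside_off_line AB PQ hP.
have sEQ : sameside A B E Q.
  by apply: (sameside_trans_ncol AB _ (sameside_sym sPE) sPQ); col.
have sER : sameside A B E R.
  by apply: (sameside_trans_ncol AB _ sEQ sQR) => h; apply: n; col.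
by apply: (sameside_trans_ncol AB _ sPE sER) => h; apply: n; col.
Qed.

Lemma sameside_opposite A B P Q R : A <> B ->
  sameside A B P Q -> opposite A B Q R -> ~ collinear A B R -> opposite A B P R.
Proof.
move=> AB sPQ oQR hR; have [hP hQ _] := sPQ.
case: (sameside_or_opposite hP hR) => // sPR.
by have [] := sameside_trans AB (sameside_sym sPQ) sPR.
Qed.

Lemma opposite_trans A B P Q R : A <> B ->
  ~ collinear A B P -> ~ collinear A B Q -> ~ collinear A B R ->
  opposite A B P Q -> opposite A B Q R -> sameside A B P R.
Proof.
move=> AB hP hQ hR oPQ oQR.
have [c|] := pselect (collinear P Q R); last first.
  by move/opposite_trans_ncol; apply.
have [e|PQ] := pselect (P = Q).
  by subst; case: oPQ => X _ /(btw_facts HM)[].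
have [e|QR] := pselect (Q = R).
  by subst; case: oQR => X _ /(btw_facts HM)[].
have [<-|PR] := pselect (P = R); first exact: sameside_refl.
have [E sPE n] := sameside_off_line AB PQ hP.
have oEQ := sameside_opposite AB (sameside_sym sPE) oPQ hQ.
have [_ hE _] := sPE.
apply: (sameside_trans AB sPE); apply: (opposite_trans_ncol AB _ hE hQ hR oEQ oQR).
by move=> h; apply: n; col.
Qed.

(** * Rays, and segments and angles as sets *)

Lemma sameray_sameside A B O P Q : A <> B -> collinear A B O ->
  ~ collinear A B P -> sameray O P Q -> sameside A B P Q.
Proof.
move=> AB hO hP [PO QO c nb]; split=> //; first by move=> h; apply: hP; col.
case=> X hX b; have [e|XO] := pselect (X = O); first by subst.
note_btw HM b; have c' : collinear X O P by col.
by apply: hP; col.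
Qed.

Lemma sameside_sameray A B O P Q : collinear A B O ->
  sameside A B P Q -> collinear O P Q -> sameray O P Q.
Proof.
move=> hO [hP hQ h] c; split=> //; [neq|neq|].
by move=> b; apply: h; exists O.
Qed.

Lemma sameray_or_btw O P Q : P <> O -> Q <> O -> collinear O P Q ->
  sameray O P Q \/ between P O Q.
Proof. by move=> PO QO c; have [|] := pselect (between P O Q); [right|left]. Qed.

Lemma sameray_refl O P : P <> O -> sameray O P P.
Proof. by move=> PO; split=> //; [col | move/(btw_facts HM)=> []]. Qed.

Lemma sameray_sym O P Q : sameray O P Q -> sameray O Q P.
Proof. by case=> PO QO c nb; split=> //; [col | move/(btw_sym HM)]. Qed.

(** Reduces to plane separation: on a line through [O], lying on one ray from [O] amounts to lying
    on one side of a second line [OB]. *)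
Lemma sameray_trans O P Q R : sameray O P Q -> sameray O Q R -> sameray O P R.
Proof.
move=> s1 s2; have [PO QO c1 _] := s1; have [_ RO c2 _] := s2.
have [B n] := exists_ncol (not_eq_sym PO); note_neq HM n.
have OB : O <> B by neq.
apply: (sameside_sameray (A := O) (B := B)); [col | | col].
apply: (sameside_trans (Q := Q) OB);
  by apply: (sameray_sameside OB _ _ (O := O)) => //; col.
Qed.

Lemma btw_sameray O P Q R : between P O Q -> sameray O Q R -> between P O R.
Proof.
move=> b s; note_btw HM b; have [QO RO c _] := s.
have [//|nb] := pselect (between P O R).
have s' : sameray O P R by split=> //; col.
by have [_ _ _ []] := sameray_trans s' (sameray_sym s).
Qed.

Lemma btw_btw_sameray O P Q R : between P O R -> between Q O R -> sameray O P Q.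
Proof.
move=> b1 b2; note_btw HM b1; note_btw HM b2.
have c : collinear O P Q by col.
have [B n] : exists B, ~ collinear O P B by apply: exists_ncol; neq.
note_neq HM n; have OB : O <> B by neq.
apply: (sameside_sameray (A := O) (B := B)); [col | | col].
apply: (opposite_trans (Q := R) OB); [col | col | col | |].
- by exists O => //; col.
- by exists O; [col | exact: btw_sym].
Qed.

Lemma btw_ray A B C : between A B C -> sameray A B C.
Proof.
move=> b; note_btw HM b; split; [neq|neq|col|].
by case: (btw_excl HM b).
Qed.

Lemma ray_eq A X Y : sameray A X Y -> ray A X = ray A Y.
Proof.
have sub U V : sameray A U V -> ray A U `<=` ray A V.
  move=> s Z [->|[ZA c nb]]; [by left | right].
  have [UA _ _ _] := s.
  have s' : sameray A U Z by split.
  by have [_ _ c' nb'] := sameray_trans (sameray_sym s) s'.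
by move=> s; apply/seteqP; split; apply: sub; last exact: sameray_sym.
Qed.

Lemma rayP A B X : B <> A -> X <> A -> ray A B X <-> sameray A B X.
Proof. by move=> BA XA; split=> [[//|[]]|[]]; [split | right]. Qed.

Lemma ray_inj A B X Y : X <> A -> Y <> B -> ray A X = ray B Y ->
  A = B /\ sameray A X Y.
Proof.
move=> XA YB e; have AB : A = B.
  apply: contrapT => AB.
  have sB : sameray A X B.
    by apply/rayP; [| exact: not_eq_sym | rewrite e; left].
  have sA : sameray B Y A by apply/rayP; rewrite -?e //; left.
  (* [Z] lies beyond [A] as seen from [B]: it is on the ray from [B] through [A] but not on the ray
     from [A] through [B]. *)
  have [Z b] := B2 HM (not_eq_sym AB).
  note_btw HM b.
  have : ray A X Z.
    rewrite e; apply/rayP; [by []|neq|].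
    exact: sameray_trans sA (btw_ray b).
  move/rayP => /(_ XA) [|_ _ _]; first neq.
  by apply; apply: (btw_sym HM); apply: btw_sameray (btw_sym HM b) (sameray_sym sB).
subst B; split=> //; apply/rayP => //; rewrite e; right.
by split=> //; [col | move/(btw_facts HM)=> []].
Qed.

Lemma segC A B : seg A B = seg B A.
Proof.
by apply/seteqP; split=> X [-> | -> | /(btw_sym HM)];
  [constructor 2 | constructor 1 | constructor 3
  |constructor 2 | constructor 1 | constructor 3].
Qed.

Lemma angC B A C : ang B A C = ang C A B.
Proof. by rewrite /ang setUC. Qed.

Lemma ang_ray A B C D E : sameray A B D -> sameray A C E -> ang B A C = ang D A E.
Proof. by move=> h1 h2; rewrite /ang (ray_eq h1) (ray_eq h2). Qed.

End Sides.

(** * Interiors of angles *)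

(** The condition of [within], stated for a single point of the ray. *)
Definition inside (G : geometry) (B A C X : Point G) :=
  sameside A B X C /\ sameside A C X B.

Section Congruence.
Variables (G : geometry) (HM : hilbert_minus G).
Implicit Types (A B C D E F O P Q R X Y Z M : Point G).

(** The crossbar theorem for the line [AX]. With [B'] beyond [A] on [AB], the segment from [X] to
    [B'] meets the ray [AC] in [Y]. So [C] and [B'] are on one side of [AX], and [B] is on the
    other. *)
Lemma inside_opposite A B C X : inside B A C X -> opposite A X B C.
Proof.
case=> sC sB; have [hX hC _] := sC; have [hX' hB _] := sB.
note_neq HM hX; note_neq HM hC.
have AB : A <> B by neq. have AC : A <> C by neq. have AX : A <> X by neq.
have [B' b] := B2 HM (not_eq_sym AB); note_btw HM b.
have oB : opposite A C B B' by exists A => //; col.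
have hB' : ~ collinear A C B' by col.
have [Y hY bY] := sameside_opposite HM AC sB oB hB'.
note_btw HM bY.
have hB'X : ~ collinear A B' X by col.
have sXY : sameside A B X Y.
  apply: (sameray_sameside HM AB _ hX (sameray_sym HM (btw_ray HM (btw_sym HM bY)))).
  col.
have sYC := sameside_trans HM AB (sameside_sym HM sXY) sC.
have rYC : sameray A Y C.
  by apply: (sameside_sameray _ sYC); col.
have [YA _ _ _] := rYC.
have hYX : ~ collinear A X Y by col.
have s1 : sameside A X Y C.
  by apply: (sameray_sameside HM AX _ hYX rYC); col.
have s2 : sameside A X Y B'.
  by apply: (sameray_sameside HM AX _ hYX (btw_ray HM bY)); col.
have s3 := sameside_trans HM AX (sameside_sym HM s1) s2.
apply: (opposite_sym HM); apply: (sameside_opposite HM AX s3); last by col.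
by exists A; [col | exact: (btw_sym HM)].
Qed.

(** A converse of the crossbar theorem: the point where the segment [CM] meets the line [AD] is on
    the side of [D] of [AC], hence on the ray [AD]. *)
Lemma opposite_inside A C D M :
  ~ collinear A D M -> opposite A D C M -> sameside A C D M -> inside C A M D.
Proof.
move=> hDM o s; have [hD hM _] := s; split=> //.
note_neq HM hD; note_neq HM hM.
have AC : A <> C by neq. have AD : A <> D by neq. have AM : A <> M by neq.
have [Y hY b] := o; note_btw HM b.
have YA : Y <> A by move=> e; subst; apply: hM; col.
have hYC : ~ collinear A C Y by move=> e; apply: hD; col.
have hMC : ~ collinear A M C by col.
have sY : sameside A C Y M.
  by apply: (sameray_sameside HM AC _ hYC (btw_ray HM b)); col.
have sYD := sameside_trans HM AC sY (sameside_sym HM s).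
have rYD : sameray A Y D by apply: (sameside_sameray _ sYD); col.
have hYM : ~ collinear A M Y by move=> e; apply: hDM; col.
apply: (sameside_trans HM AM (Q := Y)).
  by apply: (sameside_sym HM); apply: (sameray_sameside HM AM _ hYM rYD); col.
by apply: (sameray_sameside HM AM _ hYM (btw_ray HM (btw_sym HM b))); col.
Qed.

Lemma btw_inside A B C X : ~ collinear B A C -> between B X C -> inside B A C X.
Proof.
move=> n b; note_btw HM b; note_neq HM n.
have AB : A <> B by neq. have AC : A <> C by neq.
split; apply: sameside_sym => //.
- apply: (sameray_sameside HM AB _ _ (sameray_sym HM (btw_ray HM b))); col.
- by apply: (sameray_sameside HM AC _ _ (sameray_sym HM (btw_ray HM (btw_sym HM b)))); col.
Qed.

(** * Congruence of segments *)

Lemma cong_refl A B : A <> B -> cong A B A B.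
Proof. by move=> AB; apply: (C2_refl HM); exists A, B. Qed.

Lemma cong_sym A B C D : A <> B -> C <> D -> cong A B C D -> cong C D A B.
Proof.
by move=> AB CD; apply: (C2_sym HM); [exists A, B | exists C, D].
Qed.

Lemma cong_trans A B C D E F : A <> B -> C <> D -> E <> F ->
  cong A B C D -> cong C D E F -> cong A B E F.
Proof.
by move=> AB CD EF; apply: (C2_trans HM); [exists A, B | exists C, D | exists E, F].
Qed.

Lemma seg_copy A B C X : A <> B -> X <> C ->
  exists2 D, sameray C X D & cong A B C D.
Proof.
move=> AB XC; have rX : ray_from C (ray C X) by exists X.
have [D [[DC h e] _]] := C1 HM AB rX.
by exists D => //; apply/rayP.
Qed.

Lemma seg_uniq A B C D D' : A <> B -> sameray C D D' ->
  cong A B C D -> cong A B C D' -> D = D'.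
Proof.
move=> AB s e e'; have [DC D'C _ _] := s.
have rD : ray_from C (ray C D) by exists D.
have [D0 [_ u]] := C1 HM AB rD.
rewrite -(u D) ?(u D') //; split=> //; apply/rayP => //.
exact: sameray_refl.
Qed.

(** [BC] is laid off beyond [E] to [F']; by (C3) and the uniqueness in (C1), [F'] is [F]. *)
Lemma seg_sub A B C D E F : between A B C -> sameray D E F ->
  cong A B D E -> cong A C D F -> between D E F /\ cong B C E F.
Proof.
move=> b s e1 e2; have [ED FD _ _] := s; note_btw HM b.
have BC : B <> C by neq.
have [Z bZ] := B2 HM (not_eq_sym ED); note_btw HM bZ.
have [F' rF' eF'] := @seg_copy B C E Z BC ltac:(neq).
have b' : between D E F' := btw_sameray HM bZ rF'.
have sDF : sameray D F' F.
  exact: sameray_trans (sameray_sym HM (btw_ray HM b')) s.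
have <- // : F' = F.
by apply: (seg_uniq _ sDF (C3 HM b b' e1 eF')) => //; neq.
Qed.

(** Serves for the feet [H] and [K] of two altitudes. The assumed equivalence fixes on which ray
    each foot lies; addition or subtraction of segments gives the rest of the order. *)
Lemma segs_transport A C H D F K : A <> C -> D <> F -> H <> C -> K <> F ->
  H <> A -> K <> D -> collinear A C H -> collinear D F K ->
  (between H A C <-> between K D F) ->
  cong A H D K -> cong A C D F ->
  [/\ cong H C K F, between A H C <-> between D K F
    & between A C H <-> between D F K].
Proof.
move=> AC DF HC KF HA KD cH cK iff eH eC.
(* Used twice, the second time with the roles of [C] and [H] exchanged. *)
have key A' C' H' D' F' K' : between A' H' C' -> sameray D' K' F' ->
    cong A' H' D' K' -> cong A' C' D' F' ->
    [/\ cong H' C' K' F', between A' H' C' <-> between D' K' F'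
    & between A' C' H' <-> between D' F' K'].
  move=> b s e1 e2; have [b' e3] := seg_sub b s e1 e2.
  have [_ n1] := btw_excl HM b; have [_ n2] := btw_excl HM b'.
  by split.
have [b|nb] := pselect (between H A C).
  have b' := iff.1 b; split.
  - by apply: (C3 HM b b') => //; rewrite segC // (segC HM K).
  - by have [n _] := btw_excl HM b; have [n' _] := btw_excl HM b'.
  - have [_ n] := btw_excl HM (btw_sym HM b).
    have [_ n'] := btw_excl HM (btw_sym HM b').
    by split=> // /(btw_sym HM) h; [case: (btw_excl HM b)|case: (btw_excl HM b')].
have s : sameray D K F by split; [neq|neq|col| tauto].
have [b|b] : between A H C \/ between A C H.
  have AH : A <> H by neq.
  by case: (B3 HM AH AC HC) => [|[]|[]|[]]; [col|left|tauto|right].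
- exact: key.
- have [h1 h2 h3] := key _ _ _ _ _ _ b (sameray_sym HM s) eC eH.
  by split=> //; rewrite (segC HM H) (segC HM K).
Qed.

(** * Congruence of angles *)

Lemma acong_refl B A C : ~ collinear B A C -> acong B A C B A C.
Proof. by move=> n; apply: (C5_refl HM); exists B, A, C. Qed.

Lemma acong_sym B A C E D F : ~ collinear B A C -> ~ collinear E D F ->
  acong B A C E D F -> acong E D F B A C.
Proof.
by move=> n n'; apply: (C5_sym HM); [exists B, A, C | exists E, D, F].
Qed.

Lemma acong_trans B A C E D F Y X Z :
  ~ collinear B A C -> ~ collinear E D F -> ~ collinear Y X Z ->
  acong B A C E D F -> acong E D F Y X Z -> acong B A C Y X Z.
Proof.
by move=> n n' n''; apply: (C5_trans HM);
  [exists B, A, C | exists E, D, F | exists Y, X, Z].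
Qed.

Lemma sameray_sameside_of A D F P X : D <> F -> ~ collinear D F A ->
  sameside D F A P -> ray D A X -> X <> D -> same_side_of D F X P.
Proof.
move=> DF n s rX XD; apply/(same_side_ofE HM) => //.
have AD : A <> D by neq.
have s' : sameray D A X by apply/rayP.
apply: (sameside_trans HM DF) s; apply: sameside_sym => //.
by apply: (sameray_sameside HM DF _ n s'); col.
Qed.

Lemma angle_copy B A C D F P : ~ collinear B A C -> ~ collinear D F P ->
  exists2 E, sameside D F E P & acong B A C E D F.
Proof.
move=> n hP; note_neq HM hP; have DF : D <> F by neq.
have [r [[[E ED ->] h e] _]] := C4 HM n DF hP.
exists E => //; apply/(same_side_ofE HM) => //; apply: h => //.
by apply/rayP => //; apply: sameray_refl.
Qed.

Lemma angle_uniq B A C D F E E' : ~ collinear B A C -> sameside D F E E' ->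
  acong B A C E D F -> acong B A C E' D F -> sameray D E E'.
Proof.
move=> n s e e'; have [h h' _] := s; note_neq HM h; note_neq HM h'.
have DF : D <> F by neq. have ED : E <> D by neq. have E'D : E' <> D by neq.
have [r [_ u]] := C4 HM n DF h.
have [] // := @ray_inj _ HM D D E E' ED E'D.
rewrite -(u (ray D E)) ?(u (ray D E')) //; split=> //.
- by exists E'.
- by move=> X; apply: (sameray_sameside_of DF h' (sameside_sym HM s)).
- by exists E.
- by move=> X; apply: (sameray_sameside_of DF h (sameside_refl HM h)).
Qed.

End Congruence.

(** * The calculus of angles from (RCT) *)

Section Angles.
Variables (G : geometry) (HM : hilbert_minus G) (hRCT : RCT G).
Implicit Types (A B C D E F O P Q R X Y Z M : Point G).

(** (RCT) gives some ray inside [B'A'C']. It makes the same angle with [A'B'] as [A'X'], on the same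
    side, so the uniqueness in (C4) identifies the two rays. *)
Lemma angle_sub A B C A' B' C' X X' :
  ~ collinear B A C -> ~ collinear B' A' C' -> acong B A C B' A' C' ->
  inside B A C X -> sameside A' B' X' C' -> acong B A X B' A' X' ->
  inside B' A' C' X' /\ acong C A X C' A' X'.
Proof.
move=> n n' e [s1 s2] s' eX; note_neq HM n; note_neq HM n'.
have [h1 _ _] := s1; have [h2 _ _] := s2; note_neq HM h1.
have AB : A <> B by neq. have AC : A <> C by neq. have AX : A <> X by neq.
have A'B' : A' <> B' by neq. have A'C' : A' <> C' by neq.
have w : within (ray A X) B A C.
  split; first by exists X => //; neq.
  by move=> Z hZ ZA; split;
    [apply: (sameray_sameside_of HM AB h1 s1 hZ ZA)
    |apply: (sameray_sameside_of HM AC h2 s2 hZ ZA)].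
have [r [[[R RA ->] hR] e1 e2]] := hRCT n n' e w.
have [||s3 s4] := hR R; [|by []|].
  by apply/rayP => //; apply: sameray_refl.
move/(same_side_ofE HM): s3 => /(_ A'B') s3.
move/(same_side_ofE HM): s4 => /(_ A'C') s4.
have [h3 _ _] := s3; have [h4 _ _] := s4.
have sr : sameray A' R X'.
  have n1 : ~ collinear B A X by col.
  apply: (angle_uniq HM n1 (D := A') (F := B')).
  - exact: (sameside_trans HM A'B' s3 (sameside_sym HM s')).
  - by rewrite (angC R).
  - by rewrite (angC X').
split; last by rewrite /ang -(ray_eq HM sr).
split=> //; apply: (sameside_trans HM A'C') s4; apply: (sameside_sym HM).
by apply: (sameray_sameside HM A'C' _ h4 sr); col.
Qed.

(* Otherwise the angle [B'A'M], copied at [AB], would have [AC] inside it and the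
   ray of [D] as its second side by the uniqueness in (C4); but that ray is
   opposite to [AB]. *)
Lemma supplement_aux A B C D A' B' C' D' M :
  ~ collinear B A C -> ~ collinear B' A' C' ->
  between B A D -> between B' A' D' -> acong B A C B' A' C' ->
  acong C A D C' A' M -> ~ inside C' A' D' M.
Proof.
move=> n n' b b' e eM i; note_neq HM n; note_neq HM n'; note_btw HM b; note_btw HM b'.
have [s1 s2] := i; have [hM _ _] := s1; have [hM' _ _] := s2; note_neq HM hM.
have A'M : A' <> M by neq. have D'A' : D' <> A' by neq.
have A'B' : A' <> B' by neq. have AB : A <> B by neq. have AC : A <> C by neq.
have cB : ~ collinear A' B' M by move=> h; apply: hM'; col.
have i' : inside B' A' M C'.
  split.
    by apply: (sameside_line HM (not_eq_sym D'A')) => //; [col | col | exact: sameside_sym].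
  apply: (opposite_trans HM A'M (Q := D')); [col | col | col | |].
  - exact: inside_opposite i.
  - by exists A'; [col | exact: (btw_sym HM)].
have nB'M : ~ collinear M A' B' by col.
have nABC : ~ collinear A B C by col.
have [N sN eN] := angle_copy HM nB'M nABC.
have [hN _ _] := sN.
have [||||||iN eN'] := @angle_sub A' B' M A B N C' C.
- by col.
- by col.
- by rewrite (angC B') (angC B).
- exact: i'.
- exact: sameside_sym.
- by apply: (acong_sym HM) => //; col.
have [_ [hNC _ _]] := iN.
have s3 : sameside A C N D.
  apply: (opposite_trans HM AC (Q := B)); [|col|col| |].
  - by col.
  - exact: (opposite_sym HM (inside_opposite HM iN)).
  - by exists A => //; col.
have nCAD : ~ collinear C A D by col.
have [ND _ cND _] : sameray A N D.
  apply: (angle_uniq HM nCAD s3).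
    apply: (acong_trans HM nCAD _ _ eM); [col | | ].
      by col.
    by rewrite (angC C').
  by rewrite (angC D); apply: acong_refl.
by apply: hN; col.
Qed.

(** The angle [CAD] is copied at [A'C'] as [C'A'M]. If [M] is off the line [A'D'], either [M] is
    inside [C'A'D'], or [D'] is inside [C'A'M]. The second case turns into the first with the two
    figures exchanged, and [supplement_aux] excludes both. *)
Lemma supplement A B C D A' B' C' D' :
  ~ collinear B A C -> ~ collinear B' A' C' ->
  between B A D -> between B' A' D' -> acong B A C B' A' C' ->
  acong D A C D' A' C'.
Proof.
move=> n n' b b' e; note_neq HM n; note_neq HM n'; note_btw HM b; note_btw HM b'.
have nCAD : ~ collinear C A D by col.
have nCAD' : ~ collinear C' A' D' by col.
have nACD : ~ collinear A C D by col.
have nACD' : ~ collinear A' C' D' by col.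
have AC : A <> C by neq. have AC' : A' <> C' by neq. have AD' : A' <> D' by neq.
have [M sM eM] := angle_copy HM nCAD nACD'; have [hM _ _] := sM.
note_neq HM hM.
have [c|hDM] := pselect (collinear A' D' M).
  have r : sameray A' M D' by apply: (sameside_sameray _ sM); col.
  have CA' : C' <> A' by neq.
  rewrite -(ang_ray HM r (sameray_refl HM CA')) angC; exact: eM.
exfalso; rewrite (angC M) in eM.
have hDC : ~ collinear A' D' C' by col.
have [s|o] := sameside_or_opposite hDM hDC.
  exact: (supplement_aux n n' b b' e eM (conj sM s)).
have i := opposite_inside HM hDM (opposite_sym HM o) (sameside_sym HM sM).
have [N sN eN] := angle_copy HM nCAD' nACD; rewrite (angC N) in eN.
have [hN _ _] := sN.
have [||||||iN _] := @angle_sub A' C' M A C D D' N => //.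
- by col.
- by apply: acong_sym => //; col.
apply: (supplement_aux n' n b' b _ eN iN).
exact: acong_sym.
Qed.

Lemma vertical A B C D E : ~ collinear B A C ->
  between B A D -> between C A E -> acong D A C E A B.
Proof.
move=> n b b'; apply: (supplement n _ b b'); first by col.
by rewrite (angC C); apply: acong_refl.
Qed.

(** The angle [BAC] is copied as [B'A'K]. By [angle_sub] the rays [A'K] and [A'C'] make congruent
    angles with [A'X']; both lie across it from [B'], so they coincide. *)
Lemma angle_add A B C A' B' C' X X' :
  ~ collinear B A C -> ~ collinear B' A' C' ->
  inside B A C X -> inside B' A' C' X' ->
  acong B A X B' A' X' -> acong C A X C' A' X' -> acong B A C B' A' C'.
Proof.
move=> n n' i i' e1 e2; note_neq HM n; note_neq HM n'.
have [s1 s2] := i; have [s1' s2'] := i'.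
have [h1 _ _] := s1; have [h2 _ _] := s2; note_neq HM h1.
have [h1' _ _] := s1'; have [h2' _ _] := s2'; note_neq HM h1'.
have nABC' : ~ collinear A' B' C' by col.
have AB' : A' <> B' by neq. have AX' : A' <> X' by neq.
have [K sK eK] := angle_copy HM n nABC'; rewrite (angC K) in eK.
have [hK _ _] := sK.
have [||||||iK eX] := @angle_sub A B C A' B' K X X' => //.
- by col.
- exact: (sameside_trans HM AB' s1' (sameside_sym HM sK)).
have nCAX : ~ collinear C A X by col.
have [_ [hXK _ _]] := iK.
have r : sameray A' K C'.
  apply: (angle_uniq HM nCAX (D := A') (F := X')) => //.
  apply: (opposite_trans HM AX' (Q := B')); [col|col|col| |].
    exact: (opposite_sym HM (inside_opposite HM iK)).
  exact: inside_opposite.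
have BA' : B' <> A' by neq.
by rewrite -(ang_ray HM (sameray_refl HM BA') r).
Qed.

Lemma ang_inj A B C A' B' C' : ~ collinear B A C -> ~ collinear B' A' C' ->
  ang B A C = ang B' A' C' ->
  A = A' /\ ((sameray A B B' /\ sameray A C C') \/ (sameray A B C' /\ sameray A C B')).
Proof.
move=> n n' e; note_neq HM n; note_neq HM n'.
have BA : B <> A by neq. have CA : C <> A by neq.
have BA' : B' <> A' by neq. have CA' : C' <> A' by neq.
have hB : ang B' A' C' (ray A B) by rewrite -e; left.
have hC : ang B' A' C' (ray A C) by rewrite -e; right.
have hB' : ang B A C (ray A' B') by rewrite e; left.
have hC' : ang B A C (ray A' C') by rewrite e; right.
have noBC : ray A B <> ray A C.
  by move=> /(ray_inj HM BA CA)[_ [_ _ c _]]; apply: n; col.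
case: hB => /[dup] h /(ray_inj HM BA) [] // AA s.
- split=> //; left; split=> //.
  case: hC => h1; first by case: noBC; rewrite h h1.
  by case: (ray_inj HM CA CA' h1).
- split=> //; right; split=> //.
  case: hC => h1; last by case: noBC; rewrite h h1.
  by case: (ray_inj HM CA BA' h1).
Qed.

(** The definition may prolong either side of the angle. If it is [AC] that is prolonged, the
    resulting supplement is vertical to [DAC]. *)
Lemma right_angleE A B C D : ~ collinear B A C -> between B A D ->
  right_angle (ang B A C) <-> acong B A C D A C.
Proof.
move=> n b; split=> [[_ [B' [A' [C' [D' [n' b' e ->]]]]]]|e]; last first.
  by exists (ang D A C) => //; exists B, A, C, D.
rewrite {1}e => e'; rewrite e; have [AA [[sB sC]|[sB sC]]] := ang_inj n n' e.
  subst A'; have -> // : ang D A C = ang D' A C'.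
  apply: (ang_ray HM _ sC); apply: (btw_btw_sameray HM (R := B)).
    exact: btw_sym.
  exact: (btw_sameray HM (btw_sym HM b') (sameray_sym HM sB)).
subst A'; rewrite -e; rewrite -e in e'.
have bC : between C A D'.
  by apply/(btw_sym HM)/(btw_sameray HM (btw_sym HM b'))/(sameray_sym HM).
note_neq HM n; note_btw HM b; note_btw HM bC.
have DA : D' <> A by neq.
have eD : ang D' A C' = ang D' A B.
  exact: (ang_ray HM (sameray_refl HM DA) (sameray_sym HM sB)).
rewrite eD in e'.
apply: (acong_trans HM n _ _ e'); [col|col|].
by apply: (acong_sym HM); [col|col|]; apply: vertical.
Qed.

Lemma right_cong A B C A' B' C' : ~ collinear B A C -> ~ collinear B' A' C' ->
  acong B A C B' A' C' -> right_angle (ang B A C) -> right_angle (ang B' A' C').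
Proof.
move=> n n' e; note_neq HM n; note_neq HM n'.
have [D b] : exists D, between B A D by apply: (B2 HM); neq.
have [D' b'] : exists D, between B' A' D by apply: (B2 HM); neq.
note_btw HM b; note_btw HM b'.
move/(right_angleE n b) => h; apply/(right_angleE n' b').
have e' := supplement n n' b b' e.
have n1 : ~ collinear D A C by col.
have n1' : ~ collinear D' A' C' by col.
apply: (acong_trans HM n' n n1' (acong_sym HM n n' e)).
exact: (acong_trans HM n n1 n1' h).
Qed.

Lemma right_line A B C X : ~ collinear B A C -> X <> A -> collinear B A X ->
  right_angle (ang B A C) -> right_angle (ang X A C).
Proof.
move=> n XA c h; note_neq HM n.
have BA : B <> A by neq. have CA : C <> A by neq.
have [|s|b] := sameray_or_btw BA XA; first by col.
  by rewrite -(ang_ray HM s (sameray_refl HM CA)).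
apply: (right_cong n _ _ h); first by col.
exact/(right_angleE n b).
Qed.

(** Treats together the two positions of a point on a side's line, on the ray or beyond the vertex;
    the latter uses [supplement]. *)
Lemma acong_line A B C X A' B' C' X' :
  ~ collinear B A C -> ~ collinear B' A' C' -> X <> A -> X' <> A' ->
  collinear B A X -> collinear B' A' X' ->
  (between B A X <-> between B' A' X') ->
  acong B A C B' A' C' -> acong X A C X' A' C'.
Proof.
move=> n n' XA XA' c c' iff e; note_neq HM n; note_neq HM n'.
have BA : B <> A by neq. have CA : C <> A by neq.
have BA' : B' <> A' by neq. have CA' : C' <> A' by neq.
have [|s|b] := sameray_or_btw BA XA; first by col.
  rewrite -(ang_ray HM s (sameray_refl HM CA)).
  rewrite -(ang_ray HM (B := B') (C := C') _ (sameray_refl HM CA')) //.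
  by split=> //; [col | move/iff; have [] := s].
exact: (supplement n n' b (iff.1 b) e).
Qed.

End Angles.

(** * Perpendiculars and right triangles *)

Section Triangles.
Variables (G : geometry) (HM : hilbert_minus G).
Variables (hHA : HA G) (hRCT : RCT G) (hPE : PE G).
Implicit Types (A B C D E F H K N O P X Y Z : Point G).

(** (PE) provides only one pair of perpendicular rays; [right_line] replaces their points by [B] and
    by an arbitrary [Z]. *)
Lemma foot A C B : ~ collinear A C B -> exists2 H, collinear A C H &
  forall Z, collinear A C Z -> Z <> H -> right_angle (ang Z H B).
Proof.
move=> n; note_neq HM n; have AC : A <> C by neq.
have [l [Al Cl]] := exists_line HM A C.
have onE X := collinear_on HM X AC Al Cl.
have [|m Bm [O [P [Q [[Om Ol] [Pm PO] [Ql QO] r]]]]] := @hPE l B.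
  by move/onE.
have hO : collinear A C O by apply/onE.
have hQ : collinear A C Q by apply/onE.
have OQ : O <> Q by neq.
have BO : B <> O by neq.
have cB : collinear P O B by exists m.
have nQOB : ~ collinear Q O B by move=> h; apply: n; col.
have nPOQ : ~ collinear P O Q by col.
exists O => // Z hZ ZO.
have cZ : collinear Q O Z by col.
apply: (right_line HM hRCT nQOB ZO cZ).
rewrite angC; exact: (right_line HM hRCT nPOQ BO cB r).
Qed.

(* For a point [O] beyond [A] on the line [AB], the right triangles [OPA] and
   [OPB] share the hypotenuse [OP] and the angle at [O]; by (HA) [OA] and [OB]
   are congruent, so [A = B]. *)
Lemma foot_unique P A B : ~ collinear P A B ->
  right_angle (ang P A B) -> right_angle (ang P B A) -> False.
Proof.
move=> n rA rB; note_neq HM n.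
have [O b] : exists O, between B A O by apply: (B2 HM); neq.
note_btw HM b.
have nA : ~ collinear O P A by col.
have nB : ~ collinear O P B by col.
have OA : O <> A by neq. have OB : O <> B by neq. have PO : P <> O by neq.
have sO : sameray O A B by apply/btw_ray/btw_sym.
have [||||[_ _ e] _] := @hHA O P A O P B nA nB.
- apply: (right_line HM hRCT (B := B)); [col|neq|col|].
  by rewrite angC.
- apply: (right_line HM hRCT (B := A)); [col|neq|col|].
  by rewrite angC.
- by apply: (cong_refl HM); neq.
- rewrite -(ang_ray HM (sameray_refl HM PO) sO); apply: (acong_refl HM); col.
suff : A = B by neq.
apply: (seg_uniq HM (A := O) (B := A) OA sO); first exact: cong_refl.
by rewrite (segC HM O A) (segC HM O B).
Qed.

(* [B] is on the side of [C] of the perpendicular at [A]: the angle at [A] is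
   acute.  Otherwise a point of that perpendicular would have both feet [A] and
   [C] on the line [AC]. *)
Lemma acute_side A B C N : ~ collinear A B C -> right_angle (ang A C B) ->
  ~ collinear N A C -> right_angle (ang N A C) -> sameside A N B C.
Proof.
move=> n rC n' rA; note_neq HM n; note_neq HM n'.
have nANC : ~ collinear A N C by col.
have key Y : collinear A N Y -> Y <> A -> collinear B Y C -> Y <> C -> False.
  move=> c YA c' YC; have nY : ~ collinear Y A C by col.
  apply: (foot_unique nY).
    by apply: (right_line HM hRCT n' YA _ rA); col.
  apply: (right_line HM hRCT (B := B)); [col|neq|col|].
  by rewrite angC.
have [c|nB] := pselect (collinear A N B).
  by case: (key B); [|neq|col|neq].
case: (sameside_or_opposite nB nANC) => // -[Y c b]; note_btw HM b.
have YA : Y <> A by move=> e; subst; apply: n; col.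
by case: (key Y c YA); [col|neq].
Qed.

(** Congruent right angles [NAC] and [N'DF] are erected. Since [B] is inside the first, [angle_sub]
    would put [E] on the side of [F] of [DN'], while [acute_side] puts it on the side of [K]. *)
Lemma acute_mismatch A B C D E F K :
  ~ collinear A B C -> ~ collinear D E K ->
  right_angle (ang A C B) -> right_angle (ang D K E) ->
  between K D F -> ~ acong B A C E D F.
Proof.
move=> n n' rC rK b e; note_neq HM n; note_neq HM n'; note_btw HM b.
have nACB : ~ collinear A C B by col.
have nDFE : ~ collinear D F E by col.
have [N sN eN] := angle_copy HM nACB nACB; have [hN _ _] := sN.
have nNAC : ~ collinear N A C by col.
have [N' sN' eN'] := angle_copy HM nNAC nDFE; have [hN' _ _] := sN'.
note_neq HM hN; note_neq HM hN'.
have nNDF : ~ collinear N' D F by col.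
have rA : right_angle (ang N A C) by apply: (right_cong HM hRCT _ _ eN).
have rD : right_angle (ang N' D F) by apply: (right_cong HM hRCT _ _ eN').
have KD : K <> D by neq. have DN : D <> N' by neq.
have nNDK : ~ collinear N' D K by col.
have sB := acute_side n rC nNAC rA.
have [||||||[_ s] _] := @angle_sub _ HM hRCT A C N D F N' B E.
- by col.
- by col.
- by rewrite (angC C) (angC F).
- by split=> //; exact: sameside_sym.
- exact: sameside_sym.
- by rewrite (angC C) (angC F).
have s' : sameside D N' E K.
  apply: (acute_side n' rK) => //.
  by rewrite angC; apply: (right_line HM hRCT (B := F)); [col|neq|col|rewrite angC].
have [_ _ []] := sameside_trans HM DN (sameside_sym HM s') s.
by exists D => //; col.
Qed.

(* Copy the angle at [A] to [D] and the hypotenuse onto its side, as [DE'].  The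
   foot of [E'] is on the ray [DF] by [acute_mismatch], so it is [F] by (HA). *)
Lemma leg_leg A B C D E F : ~ collinear A B C -> ~ collinear D E F ->
  right_angle (ang A C B) -> acong A C B D F E ->
  cong C A F D -> cong C B F E -> triangle_cong A B C D E F.
Proof.
move=> n n' rC eC eA eB; note_neq HM n; note_neq HM n'.
have nBAC : ~ collinear B A C by col. have nDFE : ~ collinear D F E by col.
have nACB : ~ collinear A C B by col.
have rF := right_cong HM hRCT nACB nDFE eC rC.
have [X sX eX] := angle_copy HM nBAC nDFE; have [hX _ _] := sX; note_neq HM hX.
have AB : A <> B by neq. have XD : X <> D by neq.
have DF : D <> F by neq. have FD : F <> D by neq.
have [E' rE' eE'] := seg_copy HM AB XD; have [_ E'D cE' _] := rE'.
have nE' : ~ collinear D F E' by move=> h; apply: hX; col.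
rewrite (ang_ray HM rE' (sameray_refl HM FD)) in eX.
have [K cK rK] := foot nE'.
have nE'DF : ~ collinear E' D F by col.
(* Otherwise the angle at [D], hence that at [A], is right, and [B] has the two feet [A] and [C] on
   [AC]. *)
have KD : K <> D.
  move=> e; subst K; apply: (foot_unique (P := B) (A := A) (B := C)); first by col.
    apply: (right_cong HM hRCT nE'DF nBAC (acong_sym HM nBAC nE'DF eX)).
    by rewrite angC; apply: rK => //; col.
  by rewrite angC.
have nDE'K : ~ collinear D E' K by col.
have rDK : right_angle (ang D K E') by apply: rK; [col | neq].
have sK : sameray D K F.
  have [|//|b] := sameray_or_btw KD FD; first by col.
  by case: (acute_mismatch n nDE'K rC rDK b).
have eK : ang E' D K = ang E' D F := ang_ray HM (sameray_refl HM E'D) sK.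
have [[e1 e2 e3] [a1 a2 a3]] : triangle_cong A B C D E' K.
  by apply: hHA => //; rewrite eK.
have KF : K = F.
  by apply: (seg_uniq HM _ sK (A := A) (B := C)); [neq | rewrite segC // (segC HM D) | rewrite segC // (segC HM D)].
subst K.
have sE : sameside D F E' E.
  apply: (sameside_trans HM DF) sX; apply: (sameside_sym HM).
  by apply: (sameray_sameside HM DF _ hX rE'); col.
(* By [a3] and [eC] both [E'] and [E] see an angle congruent to [ACB] at [F], so no comparison of
   arbitrary right angles enters. *)
have rE : sameray F E' E.
  apply: (angle_uniq HM nACB (D := F) (F := D)).
  - by apply: (sameside_line HM DF FD) => //; col.
  - by rewrite (angC E').
  - by rewrite (angC E).
have CB : C <> B by neq.
have -> // : E = E'.
apply/esym; apply: (seg_uniq HM CB rE) => //.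
by rewrite segC // (segC HM F).
Qed.

(** * Side-angle-side *)

(** The altitudes [BH] and [EK] cut off right triangles at [A] and [D], congruent by (HA). Then [HC]
    and [KF] are congruent, and [leg_leg] compares the right triangles at [C] and [F]. The angle at
    [B] comes in [sas] by exchanging [B] and [C]. *)
Lemma sas_half A B C D E F : ~ collinear A B C -> ~ collinear D E F ->
  cong A B D E -> cong A C D F -> acong B A C E D F ->
  cong B C E F /\ acong A C B D F E.
Proof.
move=> n n' eB eC eA; note_neq HM n; note_neq HM n'.
have nACB : ~ collinear A C B by col. have nDFE : ~ collinear D F E by col.
have nBAC : ~ collinear B A C by col. have nEDF : ~ collinear E D F by col.
have nCAB : ~ collinear C A B by col. have nFDE : ~ collinear F D E by col.
have BA : B <> A by neq. have ED : E <> D by neq.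
have CA : C <> A by neq. have FD : F <> D by neq.
have AC : A <> C by neq. have DF : D <> F by neq.
have eA' := acong_sym HM nBAC nEDF eA.
have [H hH rH] := foot nACB; have [K hK rK] := foot nDFE.
have [HA|HA] := pselect (H = A).
  subst H.
  have rA : right_angle (ang C A B) by apply: rH => //; col.
  have [||||||[e1 _ _] [a1 _ _]] := @leg_leg C B A F E D => //; try col.
  - by rewrite (angC C) (angC F).
  - by rewrite (segC HM B) (segC HM E) (angC A) (angC D).
have KD : K <> D.
  move=> e; subst K; apply: (foot_unique (P := B) (A := A) (B := H)); first by col.
    rewrite angC; apply: (right_line HM hRCT nCAB) => //; first by col.
    apply: (right_cong HM hRCT (B := F) (A := D) (C := E)) => //.
      by rewrite (angC F) (angC C).
    by apply: rK => //; col.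
  by rewrite angC; apply: rH; [col | neq].
have nABH : ~ collinear A B H by col. have nDEK : ~ collinear D E K by col.
have rAH : right_angle (ang A H B) by apply: rH; [col | neq].
have rDK : right_angle (ang D K E) by apply: rK; [col | neq].
(* The feet lie on corresponding rays, since an acute angle is not congruent to an obtuse one
   ([acute_mismatch]). *)
have iff : between H A C <-> between K D F.
  split=> b; apply: contrapT => nb.
    have s : sameray D K F by split=> //; col.
    apply: (acute_mismatch nDEK nABH rDK rAH b).
    by rewrite (ang_ray HM (sameray_refl HM ED) s).
  have s : sameray A H C by split=> //; col.
  apply: (acute_mismatch nABH nDEK rAH rDK b).
  by rewrite (ang_ray HM (sameray_refl HM BA) s).
have iff' : between C A H <-> between F D K.
  by split=> /(btw_sym HM) /iff /(btw_sym HM).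
have eHA : acong B A H E D K.
  rewrite (angC B) (angC E).
  apply: (acong_line HM hRCT nCAB nFDE) => //; [by col|by col|].
  by rewrite (angC C) (angC F).
have [[_ e2 e3] [_ _ a3]] : triangle_cong A B H D E K by apply: hHA.
have eAH : cong A H D K by rewrite segC // (segC HM D).
have HCKF : H = C <-> K = F.
  split=> e; subst.
    have s : sameray D K F by split=> //; [col | move/iff/(btw_facts HM)=> []].
    exact: (seg_uniq HM AC s).
  have s : sameray A H C by split=> //; [col | move/iff/(btw_facts HM)=> []].
  apply: (seg_uniq HM DF s); first by apply: (cong_sym HM) => //; neq.
  by apply: (cong_sym HM) => //; neq.
have [HC|HC] := pselect (H = C).
  have KF := HCKF.1 HC; subst; split=> //.
have KF : K <> F by move/HCKF.
have [eHC i1 i2] := segs_transport HM AC DF HC KF HA KD hH hK iff eAH eC.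
have nAHB : ~ collinear A H B by col. have nDKE : ~ collinear D K E by col.
have CH : C <> H by neq. have FK : F <> K by neq.
(* [leg_leg] asks for congruent right angles; they are obtained from [a3] by moving along the lines
   [AC] and [DF]. *)
have eCH : acong C H B F K E.
  by apply: (acong_line HM hRCT nAHB nDKE CH FK) => //; col.
have nCBH : ~ collinear C B H by move=> h; apply: nACB; col.
have nFEK : ~ collinear F E K by move=> h; apply: nDFE; col.
have rCH : right_angle (ang C H B) by apply: rH; [col | neq].
have [[e4 _ _] [a4 _ _]] : triangle_cong C B H F E K.
  apply: leg_leg => //.
  by rewrite (segC HM H) (segC HM K).
split; first by rewrite (segC HM B) (segC HM E).
have nHCB : ~ collinear H C B by col. have nKFE : ~ collinear K F E by col.
apply: (acong_line HM hRCT nHCB nKFE AC DF); [col|col| |].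
  by split=> /(btw_sym HM) /i2 /(btw_sym HM).
by rewrite (angC H) (angC K).
Qed.

Lemma sas A B C D E F : ~ collinear A B C -> ~ collinear D E F ->
  cong A B D E -> cong A C D F -> acong B A C E D F ->
  triangle_cong A B C D E F.
Proof.
move=> n n' eB eC eA.
have [e1 a1] := sas_half n n' eB eC eA.
have n1 : ~ collinear A C B by col. have n1' : ~ collinear D F E by col.
have [|_ a2] := sas_half n1 n1' eC eB.
  by rewrite (angC C) (angC F).
by split; split=> //; rewrite segC // (segC HM F).
Qed.

(** * Exterior angles and side-angle-angle *)

(* If the two angles were congruent, [X] with [AX] congruent to [CB] would make
   [AXC] and [CBA] congruent, hence put [X] on the line [BC] as well. *)
Lemma exterior_angle A B C D : ~ collinear A B C -> between B A D ->
  ~ acong D A C B C A.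
Proof.
move=> n b e; note_neq HM n; note_btw HM b.
have CB : C <> B by neq. have DA : D <> A by neq. have CA : C <> A by neq.
have AC : A <> C by neq. have BC : B <> C by neq.
have [X rX eX] := seg_copy HM CB DA; have [_ XA cX _] := rX.
have bX := btw_sameray HM b rX; note_btw HM bX.
rewrite (ang_ray HM rX (sameray_refl HM CA)) in e.
have nAXC : ~ collinear A X C by move=> h; apply: n; col.
have nXAC : ~ collinear X A C by col. have nBCA : ~ collinear B C A by col.
have nBAC : ~ collinear B A C by col.
have AX : A <> X by neq.
have [_ [_ _ e']] : triangle_cong A X C C B A.
  apply: sas => //; first by col.
    exact: (cong_sym HM).
  by rewrite segC //; apply: (cong_refl HM).
(* The angles [XCA] and [YCA] are both congruent to [BAC], the second as a supplement, so [X] falls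
   on the ray [CY]. *)
have [Y bY] := B2 HM BC; note_btw HM bY.
have nYCA : ~ collinear Y C A by col.
have eY := supplement HM hRCT nXAC nBCA (btw_sym HM bX) bY e.
have s : sameside C A X Y.
  apply: (opposite_trans HM CA (Q := B)); [col|col|col| |].
  - by exists A; [col | exact: btw_sym].
  - by exists C; [col | ].
have [_ _ c _] : sameray C X Y.
  apply: (angle_uniq HM nBAC s) eY.
  rewrite (angC X) (angC B); apply: (acong_sym HM) => //; col.
have c' : collinear C B X by col.
by apply: n; col.
Qed.

(** The vertical angle [XAB] is the exterior angle for the triangle with [B] and [C] exchanged. *)
Lemma exterior_angle_adjacent A B C D : ~ collinear A B C -> between B A D ->
  ~ acong D A C A B C.
Proof.
move=> n b e; note_neq HM n; note_btw HM b.
have [X bX] : exists X, between C A X by apply: (B2 HM); neq.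
note_btw HM bX.
have nCAB : ~ collinear C A B by col. have nXAB : ~ collinear X A B by col.
have nDAC : ~ collinear D A C by col. have nCBA : ~ collinear C B A by col.
apply: (exterior_angle (A := A) (B := C) (C := B) (D := X)) => //; first by col.
apply: (acong_trans HM nXAB nDAC nCBA (vertical HM hRCT nCAB bX b)).
by rewrite (angC C).
Qed.

(** [AB] is laid off on the ray [DE] as [DX], and side-angle-side applies to [DXF]. If [X] were not
    [E], the triangle [EXF] would have an exterior angle congruent to a remote interior one. *)
Lemma saa A B C D E F : ~ collinear A B C -> ~ collinear D E F ->
  cong A C D F -> acong B A C E D F -> acong A B C D E F ->
  triangle_cong A B C D E F.
Proof.
move=> n n' eC eA eB; note_neq HM n; note_neq HM n'.
have AB : A <> B by neq. have ED : E <> D by neq. have FD : F <> D by neq.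
have nABC : ~ collinear A B C by [].
have [X rX eX] := seg_copy HM AB ED; have [_ XD cX _] := rX.
have nX : ~ collinear D X F by move=> h; apply: n'; col.
have t : triangle_cong A B C D X F.
  apply: sas => //.
  by rewrite -(ang_ray HM rX (sameray_refl HM FD)).
have [-> //|EX] := pselect (E = X).
have [_ [_ aX _]] := t.
have XE : X <> E by neq.
have e : acong D E F D X F.
  by apply: (acong_trans HM n' n nX _ aX); apply: acong_sym.
have e' : acong D X F D E F by apply: (acong_sym HM).
have nEXF : ~ collinear E X F by move=> h; apply: nX; col.
have nXEF : ~ collinear X E F by col.
have FE : F <> E by neq. have FX : F <> X by neq.
have DE : D <> E by neq. have DX : D <> X by neq.
have [b|b] : between D E X \/ between D X E.
  by case: (B3 HM DE DX EX) => [|[]|[_ b _]|[]]; [col|left|case: rX|right].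
- case: (exterior_angle_adjacent nEXF (btw_sym HM b)).
  by rewrite (ang_ray HM (btw_ray HM (btw_sym HM b)) (sameray_refl HM FX)).
- case: (exterior_angle_adjacent nXEF (btw_sym HM b)).
  by rewrite (ang_ray HM (btw_ray HM (btw_sym HM b)) (sameray_refl HM FE)).
Qed.

(** * Isosceles triangles and side-side-side *)

(** Pappus's argument: side-angle-side between the triangle and its own mirror image [ACB]. *)
Lemma isosceles A B C : ~ collinear A B C -> cong A B A C -> acong A B C A C B.
Proof.
move=> n e; note_neq HM n.
have n' : ~ collinear A C B by col.
have [||_ [_ //]] := @sas A B C A C B n n' e.
  by apply: (cong_sym HM) => //; neq.
by rewrite angC; apply: (acong_refl HM); col.
Qed.

(** With [Y] the point where [CD] meets [AB], the angles at [C] and [D] are sums or differences of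
    base angles of the isosceles triangles over [CD], according to the order of [A], [Y], [B]. If
    [Y] is [A] or [B], one base angle suffices. *)
Lemma kite A B C D : opposite A B C D -> ~ collinear A B C -> ~ collinear A B D ->
  cong A C A D -> cong B C B D -> acong A C B A D B.
Proof.
move=> [Y hY b] nC nD eA eB; note_neq HM nC; note_neq HM nD; note_btw HM b.
have AB : A <> B by neq. have BA : B <> A by neq.
have CY : sameray C D Y := sameray_sym HM (btw_ray HM b).
have DY : sameray D C Y := sameray_sym HM (btw_ray HM (btw_sym HM b)).
have CnD : C <> D by neq.
have part V : collinear A B V -> V <> Y -> V <> C -> V <> D ->
    ~ collinear V C Y -> cong V C V D -> acong V C Y V D Y.
  move=> hV VY VC VD n e; have n' : ~ collinear V C D by col.
  rewrite -(ang_ray HM (sameray_refl HM VC) CY).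
  rewrite -(ang_ray HM (sameray_refl HM VD) DY).
  exact: isosceles.
have pA : A <> Y -> acong A C Y A D Y.
  by move=> AY; apply: part; [col|by []|neq|neq|col|by []].
have pB : B <> Y -> acong B C Y B D Y.
  by move=> BY; apply: part; [col|by []|neq|neq|col|by []].
have [e|AY] := pselect (A = Y).
  by subst Y; rewrite angC (angC A D); apply: pB.
have [e|BY] := pselect (B = Y).
  by subst Y; apply: pA.
have YB : Y <> B by neq.
have eA' := pA AY; have eB' := pB BY.
have nAC : ~ collinear A C B by col. have nAD : ~ collinear A D B by col.
have nYCB : ~ collinear Y C B by move=> h; apply: nC; col.
have nYDB : ~ collinear Y D B by move=> h; apply: nD; col.
have hA : acong Y C A Y D A by rewrite (angC Y) (angC Y D).
have hB : acong Y C B Y D B by rewrite (angC Y) (angC Y D).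
have nYCA : ~ collinear Y C A by col.
have nYDA : ~ collinear Y D A by col.
case: (B3 HM AY AB YB) => [|[b' _ _]|[_ b' _]|[_ _ b']]; first by col.
- exact: (angle_add HM hRCT nAC nAD (btw_inside HM nAC b') (btw_inside HM nAD b')).
- have i := btw_inside HM nYCB b'; have [s _] := btw_inside HM nYDB b'.
  have [_ e] := angle_sub HM hRCT nYCB nYDB hB i s hA.
  by rewrite (angC A) (angC A D).
- have i := btw_inside HM nYCA (btw_sym HM b').
  have [s _] := btw_inside HM nYDA (btw_sym HM b').
  by have [_ e] := angle_sub HM hRCT nYCA nYDA hA i s hB.
Qed.

(** A copy [DEX] of [ABC] is built by side-angle-side across [DE] from [F], the side being marked by
    [P]. Then [kite] gives the angles at [F] and [X], and side-angle-side compares [FDE] with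
    [XDE]. *)
Lemma sss A B C D E F : ~ collinear A B C -> ~ collinear D E F ->
  cong A B D E -> cong B C E F -> cong C A F D ->
  triangle_cong A B C D E F.
Proof.
move=> n n' eAB eBC eCA; note_neq HM n; note_neq HM n'.
have DE : D <> E by neq. have FD : F <> D by neq. have AC : A <> C by neq.
have BC : B <> C by neq. have ED : E <> D by neq. have DF : D <> F by neq.
have EF : E <> F by neq. have FE : F <> E by neq.
have [P b] := B2 HM FD; note_btw HM b.
have nP : ~ collinear D E P by col.
have nCAB : ~ collinear C A B by col.
have [X0 s0 eX0] := angle_copy HM nCAB nP; have [hX0 _ _] := s0; note_neq HM hX0.
have X0D : X0 <> D by neq.
have [X rX eX] := seg_copy HM AC X0D; have [_ XD cX _] := rX.
rewrite (ang_ray HM rX (sameray_refl HM ED)) in eX0.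
have sX : sameside D E X P.
  apply: (sameside_trans HM DE) s0; apply: (sameside_sym HM).
  by apply: (sameray_sameside HM DE _ hX0 rX); col.
have [nX _ _] := sX; note_neq HM nX.
have EX : E <> X by neq. have DX : D <> X by neq.
have [[e1 e2 e3] [a1 a2 a3]] : triangle_cong A B C D E X.
  by apply: sas => //; rewrite (angC B) (angC E).
have o : opposite D E F X.
  apply: (opposite_sym HM); apply: (sameside_opposite HM DE sX) => //.
  by exists D; [col | exact: btw_sym].
have eD : cong D F D X.
  apply: (cong_trans HM DF AC DX _ eX); apply: (cong_sym HM) => //.
  by rewrite segC // (segC HM D).
have eE : cong E F E X.
  by apply: (cong_trans HM EF BC EX _ e2); apply: (cong_sym HM).
have k := kite o n' nX eD eE.
have nXDE : ~ collinear X D E by col. have nFDE : ~ collinear F D E by col.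
have [_ [b1 b2 b3]] : triangle_cong F D E X D E.
  by apply: sas => //; rewrite segC // (segC HM X).
have nBAC : ~ collinear B A C by col.
have nACB : ~ collinear A C B by col.
have nEDX : ~ collinear E D X by col. have nEDF : ~ collinear E D F by col.
have nDXE : ~ collinear D X E by col. have nDFE : ~ collinear D F E by col.
split; split=> //.
- apply: (acong_trans HM nBAC nEDX nEDF a1); apply: (acong_sym HM) => //.
  by rewrite (angC E) (angC E D X).
- apply: (acong_trans HM n nX n' a2); apply: (acong_sym HM) => //.
  by rewrite (angC D) (angC D E X).
- by apply: (acong_trans HM nACB nDXE nDFE a3); apply: (acong_sym HM).
Qed.

End Triangles.

Theorem corollary2p2 (G : geometry) (HM : hilbert_minus G)
  (hHA : HA G) (hRCT : RCT G) (hPE : PE G) :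
  (forall A B C D E F : Point G,
     ~ collinear A B C -> ~ collinear D E F ->
     segcong (seg A B) (seg D E) ->
     segcong (seg B C) (seg E F) ->
     segcong (seg C A) (seg F D) ->
     triangle_cong A B C D E F)
  /\
  (forall A B C D E F : Point G,
     ~ collinear A B C -> ~ collinear D E F ->
     segcong (seg A C) (seg D F) ->
     angcong (ang B A C) (ang E D F) ->
     angcong (ang A B C) (ang D E F) ->
     triangle_cong A B C D E F).
Proof. by split; [exact: sss | exact: saa]. Qed.
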